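(* Let $n\ge 1$. The number of meet-irreducible elements of the lattice $\mathcal{L}(n)$ is $n(2^{n-1}-n)$.
   Context: A finite atomic lattice is a finite lattice in which every element other than the minimum $\hat 0$ is a join of atoms, an atom being an element covering $\hat 0$. $\mathcal{L}(n)$ is the set of all finite atomic lattices with $n$ ordered atoms (up to isomorphism respecting the ordering of the atoms), partially ordered by: $Q\leq P$ if and only if there is a join-preserving map $P\to Q$ which is a bijection on atoms (respecting the ordering). Equivalently, a finite atomic lattice with $n$ ordered atoms is identified with a set $\mathcal{S}$ of subsets of $\{1,\dots,n\}$ that is closed under intersections and contains $\emptyset$, $\{1,\dots,n\}$ and all singletons $\{i\}$ (ordered by inclusion), and $Q\le P$ if and only if $\mathcal{S}_Q\subseteq\mathcal{S}_P$. With this order $\mathcal{L}(n)$ is a finite lattice. An element $x$ of a finite lattice, $x\neq\hat 1$, is meet-irreducible if $x\neq a\wedge b$ for all $a>x$, $b>x$; equivalently, $x$ is covered by exactly one element. *)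

(* Defs.v *)
From HB Require Import structures.
From mathcomp Require Import all_boot all_order.

Set Implicit Arguments.
Unset Strict Implicit.
Unset Printing Implicit Defensive.

Import Order.TTheory.
Local Open Scope order_scope.

Definition covers (d : Order.disp_t) (T : porderType d) (x y : T) : Prop :=
  x < y /\ forall z : T, ~~ (x < z < y).

Definition is_atom (d : Order.disp_t) (T : finTBLatticeType d) (a : T) : Prop :=
  covers \bot a.

Definition atomic (d : Order.disp_t) (T : finTBLatticeType d) : Prop :=
  forall x : T, x != \bot ->
    exists2 A : {set T}, (forall a, a \in A -> is_atom a)
                       & x = \join_(a in A) a.

(* The ordering of the atoms is an enumeration, without repetition, of all the
   atoms by 'I_n. *)
Record atomicLattice (n : nat) := AtomicLattice {
  al_disp : Order.disp_t;
  al_sort :> finTBLatticeType al_disp;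
  al_atom : 'I_n -> al_sort;
  al_atomic : atomic al_sort;
  al_atom_inj : forall i j : 'I_n, al_atom i = al_atom j -> i = j;
  al_atomP : forall a : al_sort, is_atom a <-> exists i : 'I_n, a = al_atom i
}.

Definition al_iso (n : nat) (P Q : atomicLattice n) : Prop :=
  exists f : P -> Q, [/\ bijective f,
    forall x y : P, (f x <= f y) = (x <= y)
    & forall i : 'I_n, f (al_atom P i) = al_atom Q i].

Definition al_le (n : nat) (Q P : atomicLattice n) : Prop :=
  exists f : P -> Q,
    (forall x y : P, f (x `|` y) = f x `|` f y) /\
    (forall i : 'I_n, f (al_atom P i) = al_atom Q i).

(* An element of L n is an isomorphism class, represented by its
   characteristic predicate. The MathComp quotient types and classical sets
   are not available here: they would require a choiceType (resp. set) over the
   universe of all finite lattices, which is a universe inconsistency. *)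
Record L (n : nat) := LClass {
  L_class :> atomicLattice n -> Prop;
  L_classP : exists P : atomicLattice n, L_class = al_iso P
}.

Definition L_le (n : nat) (x y : L n) : Prop :=
  exists Q P : atomicLattice n, [/\ x Q, y P & al_le Q P].

Section Poset.
Variables (T : Type) (le : T -> T -> Prop).

Definition lt_of (x y : T) : Prop := le x y /\ x <> y.

Definition is_top (x : T) : Prop := forall y, le y x.

Definition is_meet (a b x : T) : Prop :=
  [/\ le x a, le x b & forall y, le y a -> le y b -> le y x].

Definition meet_irreducible (x : T) : Prop :=
  ~ is_top x /\
  forall a b : T, lt_of x a -> lt_of x b -> ~ is_meet a b x.

End Poset.

Definition has_card (T : Type) (A : T -> Prop) (N : nat) : Prop :=
  exists f : 'I_N -> T,
    (forall i j, f i = f j -> i = j) /\ (forall x, A x <-> exists i, x = f i).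

(* Main.v *)
Require Import Defs.
From mathcomp Require Import all_boot all_order.
From HB Require Import structures.
From Stdlib Require Import FunctionalExtensionality PropExtensionality.
From Stdlib Require Import ProofIrrelevance.

(** An atomic lattice P with atoms a_1, ..., a_n is determined by the family of
    its supports {i | a_i <= x}, x in P, since x is the join of the atoms below
    it. These families are exactly the [atom_system]s: intersection-closed
    families containing the empty set, the full set and all singletons. A
    join-preserving map P -> Q respecting the atoms exists if and only if the
    supports of Q are among those of P ([al_leP]), so L(n) is isomorphic to the
    poset of atom systems under inclusion ([class_of_inj], [class_of_surj],
    [L_leP]), in which meets are intersections.

    An intersection-closed family is the set of models of the implications
    A -> i that it satisfies. The implication A -> i has an atom system as its
    family of models, with i not in A, precisely when A has at least two
    elements: otherwise it would exclude the empty set or a singleton. Hence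
    every atom system is an intersection of the families [obeys (A, i)]
    ([system_rules]), and a meet-irreducible one must be a single such family
    ([irreducible_rule_system]).

    Conversely, obeys (A, i) is meet-irreducible because A belongs to every
    strictly larger atom system ([premise_above_obeys]): such a system has a
    member B violating the rule, and A is the intersection of B with
    i |: A, which obeys the rule. So two strictly larger systems cannot
    intersect in obeys (A, i). Distinct rules have distinct families of models
    ([obeys_inj]), and for each of the n conclusions i the premises are the
    subsets of the other n - 1 indices other than the empty set and the n - 1
    singletons: 2 ^ (n - 1) - n of them. *)

Set Implicit Arguments.
Unset Strict Implicit.
Unset Printing Implicit Defensive.

Import Order.TTheory.
Local Open Scope order_scope.

(** * Supports in an atomic lattice *)

Section Supports.
Variables (n : nat) (P : atomicLattice n).

Definition supp (x : P) : {set 'I_n} := [set i | al_atom P i <= x].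

Definition atom_join (A : {set 'I_n}) : P := \join_(i in A) al_atom P i.

Definition supports : {set {set 'I_n}} := [set supp x | x : P].

Lemma supp_in x : supp x \in supports.
Proof. exact: imset_f. Qed.

Lemma al_atom_covers i : covers \bot (al_atom P i).
Proof. by apply/al_atomP; exists i. Qed.

Lemma atom_join_le A (x : P) : (atom_join A <= x) = (A \subset supp x).
Proof.
apply/joinsP/subsetP => [Ax i iA|Ax i /Ax]; last by rewrite inE.
by rewrite inE; apply: Ax.
Qed.

Lemma suppK (x : P) : atom_join (supp x) = x.
Proof.
apply: le_anti; rewrite atom_join_le subxx /=.
have [->|x_neq0] := eqVneq x \bot; first exact: le0x.
have [A atomA defx] := al_atomic x_neq0.
rewrite [leLHS]defx; apply/joinsP => a aA.
have /al_atomP [i defa] := atomA a aA.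
rewrite defa; apply: joins_sup; rewrite inE -defa defx.
exact: joins_sup.
Qed.

Lemma supp_le (x y : P) : (supp x \subset supp y) = (x <= y).
Proof. by rewrite -atom_join_le suppK. Qed.

Lemma supp_inj : injective supp.
Proof. by move=> x y xy; rewrite -[x]suppK xy suppK. Qed.

Lemma atom_joinK A : A \in supports -> supp (atom_join A) = A.
Proof. by case/imsetP=> x _ ->; rewrite suppK. Qed.

Lemma supp0 : supp \bot = set0.
Proof.
apply/setP=> i; rewrite !inE; apply/negP.
by have [/lt_geF -> _] := al_atom_covers i.
Qed.

Lemma supp_atom i : supp (al_atom P i) = [set i].
Proof.
apply/setP=> j; rewrite !inE; apply/idP/eqP => [ji|-> //].
have [_ /(_ (al_atom P j))] := al_atom_covers i.
have [-> _] := al_atom_covers j.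
rewrite lt_neqAle ji andbT negbK => /eqP; exact: al_atom_inj.
Qed.

Lemma suppI x y : supp (x `&` y) = supp x :&: supp y.
Proof. by apply/setP=> i; rewrite !inE lexI. Qed.

Lemma suppT : supp \top = setT.
Proof. by apply/setP=> i; rewrite !inE lex1. Qed.

End Supports.

(** * Comparing atomic lattices through their supports *)

Definition atom_system n (S : {set {set 'I_n}}) : bool :=
  [&& set0 \in S, setT \in S, [forall i, [set i] \in S]
    & [forall A in S, forall B in S, A :&: B \in S]].

Lemma atom_systemP n (S : {set {set 'I_n}}) :
  reflect [/\ set0 \in S, setT \in S, forall i, [set i] \in S
            & forall A B, A \in S -> B \in S -> A :&: B \in S]
          (atom_system S).
Proof.
apply: (iffP and4P) => -[S0 ST S1 SI]; split=> //.
- exact/forallP.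
- by move=> A B SA SB; apply: (forall_inP (forall_inP SI _ SA)).
- exact/forallP.
- by apply/forall_inP => A SA; apply/forall_inP => B; apply: SI.
Qed.

Lemma supports_system n (P : atomicLattice n) : atom_system (supports P).
Proof.
apply/atom_systemP; split.
- by rewrite -(supp0 P) supp_in.
- by rewrite -(suppT P) supp_in.
- by move=> i; rewrite -(supp_atom P) supp_in.
- by move=> _ _ /imsetP[x _ ->] /imsetP[y _ ->]; rewrite -suppI supp_in.
Qed.

(** Given f : P -> Q, if y : Q has a nonempty support, then the join in P of the
    atoms supporting y has the same support, because f sends it below y; the
    empty support is that of \bot in P. Conversely,
    sending x : P to the join in Q of the atoms supporting x preserves joins:
    the support in Q of an upper bound of f x and f y is also the support of
    some w : P, which is then above x and y, hence above their join. *)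
Lemma al_leP n (Q P : atomicLattice n) :
  al_le Q P <-> supports Q \subset supports P.
Proof.
split=> [[f [fU f_atom]]|sQP].
  have f_homo x y : x <= y -> f x <= f y.
    by move=> xy; rewrite -(join_idPl xy) fU leUr.
  apply/subsetP => _ /imsetP[y _ ->].
  have [-> | [k ky]] := set_0Vmem (supp y).
    by rewrite -(supp0 P) supp_in.
  suff <- : supp (atom_join P (supp y)) = supp y by apply: supp_in.
  apply/eqP; rewrite eqEsubset -(atom_join_le (supp y)) lexx andbT.
  have f_join : f (atom_join P (supp y)) <= y.
    apply: (big_ind (fun x => f x <= y)) => [|x z fx fz|i].
    (* f need not send \bot to \bot, but f \bot is below every f (atom k). *)
    - by move: ky; rewrite inE -f_atom; apply: le_trans; apply/f_homo/le0x.
    - by rewrite fU leUx fx.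
    - by rewrite f_atom inE.
  apply/subsetP => i; rewrite !inE -f_atom => /f_homo; move/le_trans; exact.
exists (fun x => atom_join Q (supp x)); split=> [x y|i]; last first.
  by rewrite supp_atom /atom_join big_set1.
have f_homo (u v : P) :
    u <= v -> atom_join Q (supp u) <= atom_join Q (supp v).
  rewrite atom_join_le -supp_le => /subset_trans; apply.
  by rewrite -atom_join_le.
apply: le_anti; rewrite leUx !f_homo ?leUl ?leUr // andbT atom_join_le.
set z := atom_join Q (supp x) `|` _.
have /imsetP[w _ zw] := subsetP sQP _ (supp_in z).
by rewrite zw supp_le leUx -!supp_le -zw -!atom_join_le leUl leUr.
Qed.

Lemma al_isoP n (P Q : atomicLattice n) :
  al_iso P Q <-> supports P = supports Q.
Proof.
split=> [[f [[g fK gK] f_le f_atom]]|sPQ].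
  have f_supp x : supp (f x) = supp x.
    by apply/setP=> i; rewrite !inE -f_atom f_le.
  apply/setP=> A; apply/imsetP/imsetP => -[x _ ->].
    by exists (f x); rewrite ?f_supp.
  by exists (g x); rewrite // -f_supp gK.
have supp_f (x : P) : supp (atom_join Q (supp x)) = supp x.
  by rewrite atom_joinK // -sPQ supp_in.
have supp_g (y : Q) : supp (atom_join P (supp y)) = supp y.
  by rewrite atom_joinK // sPQ supp_in.
exists (fun x => atom_join Q (supp x)); split.
- by exists (fun y => atom_join P (supp y)) => z; rewrite ?supp_f ?supp_g suppK.
- by move=> x y; rewrite -!supp_le !supp_f.
- by move=> i; apply: supp_inj; rewrite supp_f !supp_atom.
Qed.

(** * The atomic lattice of an atom system *)

Definition system n := {S : {set {set 'I_n}} | atom_system S}.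

Definition System n (S : {set {set 'I_n}}) (sysS : atom_system S) : system n :=
  exist _ S sysS.

Section Realization.
Variables (n : nat) (S : system n).

Definition member : Type := {A : {set 'I_n} | A \in val S}.
HB.instance Definition _ := Finite.on member.
HB.instance Definition _ := SubType.on member.

Definition Member (A : {set 'I_n}) (SA : A \in val S) : member := exist _ A SA.

Implicit Types A B C : {set 'I_n}.
Implicit Types x y z : member.

Let S0 : set0 \in val S. Proof. by have /atom_systemP[] := valP S. Qed.
Let ST : setT \in val S. Proof. by have /atom_systemP[] := valP S. Qed.
Let S1 i : [set i] \in val S. Proof. by have /atom_systemP[] := valP S. Qed.
Let SI A B : A \in val S -> B \in val S -> A :&: B \in val S.
Proof. by have /atom_systemP[_ _ _] := valP S; apply. Qed.

Definition closure A : {set 'I_n} := \bigcap_(C in val S | A \subset C) C.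

Lemma closure_in A : closure A \in val S.
Proof.
by apply: (big_ind (fun C => C \in val S)) => // C /andP[].
Qed.

Lemma closure_sub A C : C \in val S -> (closure A \subset C) = (A \subset C).
Proof.
move=> SC; apply/idP/idP => [|AC]; last by apply: bigcap_inf; rewrite SC.
apply: subset_trans; apply/bigcapsP => D; by case/andP.
Qed.

Definition member_le x y := val x \subset val y.

Lemma member_le_refl : reflexive member_le.
Proof. by move=> x; rewrite /member_le. Qed.

Lemma member_le_anti : antisymmetric member_le.
Proof. by move=> x y; rewrite /member_le -eqEsubset => /eqP/val_inj. Qed.

Lemma member_le_trans : transitive member_le.
Proof. by move=> y x z; apply: subset_trans. Qed.

Fact member_display : Order.disp_t. Proof. exact: Order.Disp tt tt. Qed.

HB.instance Definition _ := Order.Le_isPOrder.Build member_display member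
  member_le_refl member_le_anti member_le_trans.

Definition member_meet x y : member := Member (SI (valP x) (valP y)).
Definition member_join x y : member :=
  Member (closure_in (val x :|: val y)).

Lemma member_leE x y : (x <= y) = (val x \subset val y).
Proof. by []. Qed.

Lemma member_lexI x y z : (x <= member_meet y z) = (x <= y) && (x <= z).
Proof. by rewrite !member_leE subsetI. Qed.

Lemma member_leUx x y z : (member_join x y <= z) = (x <= z) && (y <= z).
Proof. by rewrite !member_leE (closure_sub _ (valP z)) subUset. Qed.

HB.instance Definition _ := Order.POrder_MeetJoin_isLattice.Build
  member_display member member_lexI member_leUx.

Lemma member_le0x x : Member S0 <= x.
Proof. by rewrite member_leE sub0set. Qed.

Lemma member_lex1 x : x <= Member ST.
Proof. by rewrite member_leE subsetT. Qed.

HB.instance Definition _ := Order.hasBottom.Build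
  member_display member member_le0x.
HB.instance Definition _ := Order.hasTop.Build
  member_display member member_lex1.

Definition member_atom i : member := Member (S1 i).

Lemma member_atom_le i x : (member_atom i <= x) = (i \in val x).
Proof. by rewrite member_leE sub1set. Qed.

Lemma member_atom_inj i j : member_atom i = member_atom j -> i = j.
Proof.
move=> ij; apply/set1P.
by rewrite -[[set j]]/(val (member_atom j)) -ij set11.
Qed.

Lemma member_eq0 x : (x == \bot) = (val x == set0).
Proof. by []. Qed.

Lemma member_atomP x : is_atom x <-> exists i, x = member_atom i.
Proof.
split=> [[x_gt0 x_min]|[i ->]].
  have : val x != set0 by rewrite -member_eq0 gt_eqF.
  case/set0Pn => i ix; exists i.
  have := x_min (member_atom i).
  rewrite lt0x member_eq0 /= -card_gt0 cards1 /=.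
  by rewrite lt_neqAle member_atom_le ix andbT negbK => /eqP.
have lt0i : \bot < member_atom i by rewrite lt0x member_eq0 -card_gt0 cards1.
split=> // z; apply/negP => /andP[z_gt0 zi].
have : val z != set0 by rewrite -member_eq0 gt_eqF.
case/set0Pn => j jz.
have /set1P ji : j \in [set i] by apply: subsetP (ltW zi) _ jz.
by rewrite ji -member_atom_le in jz; rewrite (le_gtF jz) in zi.
Qed.

Lemma member_atomic : atomic member.
Proof.
move=> x _; exists [set member_atom i | i in val x].
  by move=> _ /imsetP[i _ ->]; apply/member_atomP; exists i.
apply: le_anti; apply/andP; split; last first.
  by apply/joinsP => _ /imsetP[i ix ->]; rewrite member_atom_le.
apply/subsetP => i ix; rewrite -member_atom_le.
have /joinsP := lexx (\join_(a in [set member_atom j | j in val x]) a).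
by apply; apply: imset_f.
Qed.

Definition realize : atomicLattice n :=
  AtomicLattice member_atomic member_atom_inj member_atomP.

Lemma supports_realize : supports realize = val S.
Proof.
have suppE (x : realize) : supp x = val (x : member).
  by apply/setP=> i; rewrite inE member_atom_le.
apply/setP=> A; apply/imsetP/idP => [[x _ ->]|SA].
  by rewrite suppE; apply: (valP (x : member)).
by exists (Member SA); rewrite ?suppE.
Qed.

End Realization.

(** * Isomorphism classes are atom systems *)

Section Classes.
Variable n : nat.
Implicit Types (S T : system n) (x : L n).

Definition class_of S : L n :=
  LClass (ex_intro (fun P => _ = al_iso P) (realize S) erefl).

Lemma class_ofP S P : class_of S P <-> supports P = val S.
Proof. by split; rewrite /= al_isoP supports_realize. Qed.

Lemma class_of_inj : injective class_of.
Proof.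
move=> S T eqST; apply: val_inj.
rewrite -(supports_realize S); apply/class_ofP.
by rewrite -eqST; apply/class_ofP; apply: supports_realize.
Qed.

(** The classes are Prop-valued predicates carrying a proof, hence the
    extensionality axioms and proof irrelevance. *)
Lemma class_of_surj x : exists S, x = class_of S.
Proof.
case: x => C exP; have [P defC] := exP.
exists (System (supports_system P)); rewrite /class_of.
set R := realize _.
have defC' : C = al_iso R.
  rewrite defC; apply: functional_extensionality => Q.
  by apply: propositional_extensionality; rewrite !al_isoP supports_realize.
by move: exP; rewrite defC' => exP; congr LClass; apply: proof_irrelevance.
Qed.

Lemma L_leP S T : L_le (class_of S) (class_of T) <-> val S \subset val T.
Proof.
split=> [[Q [P [/class_ofP <- /class_ofP <- /al_leP]]]//|sST].
exists (realize S), (realize T).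
by split; rewrite ?class_ofP ?al_leP !supports_realize.
Qed.

End Classes.

Lemma meet_irreducible_iso (X Y : Type) (leX : X -> X -> Prop)
    (leY : Y -> Y -> Prop) (h : X -> Y) :
    injective h -> (forall y, exists x, y = h x) ->
    (forall a b, leY (h a) (h b) <-> leX a b) ->
  forall x, meet_irreducible leY (h x) <-> meet_irreducible leX x.
Proof.
move=> h_inj h_surj h_le x.
have h_lt a b : lt_of leY (h a) (h b) <-> lt_of leX a b.
  rewrite /lt_of h_le; split=> -[ab neq]; split=> //.
    by move=> /(congr1 h).
  by move=> /h_inj.
have h_top : is_top leY (h x) <-> is_top leX x.
  split=> top_x y; first exact/h_le.
  by have [x' ->] := h_surj y; apply/h_le.
have h_meet a b : is_meet leY (h a) (h b) (h x) <-> is_meet leX a b x.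
  split=> -[/h_le xa /h_le xb min_x]; split=> // y.
    by move=> ya yb; apply/h_le/min_x; apply/h_le.
  by have [x' ->] := h_surj y => /h_le ya /h_le yb; apply/h_le/min_x.
rewrite /meet_irreducible h_top.
split=> -[not_top irr]; split=> // a b.
  by rewrite -!h_lt -h_meet; apply: irr.
have [a' ->] := h_surj a; have [b' ->] := h_surj b.
by rewrite !h_lt h_meet; apply: irr.
Qed.

(** * Meet-irreducible atom systems *)

Section Implications.
Variable n : nat.
Implicit Types (A B C : {set 'I_n}) (i j : 'I_n) (S T : system n).

Definition system_le S T : Prop := val S \subset val T.

(** The pair (A, i) stands for the implication A -> i: a set containing A
    contains i. *)
Definition rules : {set {set 'I_n} * 'I_n} :=
  [set p : {set 'I_n} * 'I_n | (p.2 \notin p.1) && (1 < #|p.1|)%N].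

Definition obeys (p : {set 'I_n} * 'I_n) : {set {set 'I_n}} :=
  [set C : {set 'I_n} | (p.1 \subset C) ==> (p.2 \in C)].

(** The two elements of the premise make the rule vacuous on the empty set and
    on singletons. *)
Lemma obeys_system p : p \in rules -> atom_system (obeys p).
Proof.
case: p => A i; rewrite inE /= => /andP[_ cardA].
have small C : (#|C| <= 1)%N -> C \in obeys (A, i).
  move=> cardC; rewrite inE /=; apply/implyP => /subset_leq_card.
  by rewrite leqNgt (leq_ltn_trans cardC).
apply/atom_systemP; split.
- by rewrite small ?cards0.
- by rewrite !inE implybT.
- by move=> j; rewrite small ?cards1.
- move=> B C; rewrite !inE /= subsetI => /implyP iB /implyP iC.
  by apply/implyP => /andP[/iB -> /iC ->].
Qed.

Definition rule_system (p : {p | p \in rules}) : system n :=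
  System (obeys_system (valP p)).

Lemma premise_disobeys A i : (A, i) \in rules -> A \notin obeys (A, i).
Proof. by rewrite !inE /= subxx => /andP[/negPf->]. Qed.

(** The premise A is recovered as the least set violating the rule, and then i
    as the only element whose adjunction to A repairs it. *)
Lemma obeys_inj : {in rules &, injective obeys}.
Proof.
move=> [A i] [B j] pA pB /= eqAB.
have eA := premise_disobeys pA; have eB := premise_disobeys pB.
have {eA}sBA : B \subset A by move: eA; rewrite eqAB inE /=; case: subsetP.
have {eB}sAB : A \subset B by move: eB; rewrite -eqAB inE /=; case: subsetP.
have {sBA sAB} eAB : A = B by apply/eqP; rewrite eqEsubset sAB.
rewrite -{B}eAB in eqAB pB *; congr (_, _).
have : i |: A \in obeys (A, j) by rewrite -eqAB !inE eqxx implybT.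
rewrite !inE subsetUr /= => /orP[/eqP-> //|jA].
by move: pB; rewrite inE /= jA.
Qed.

(** A member B violating the rule contains A but not i, so cutting it by
    i |: A, which obeys the rule, leaves exactly A. *)
Lemma premise_above_obeys A i S :
  (A, i) \in rules -> obeys (A, i) \proper val S -> A \in val S.
Proof.
move=> pA /properP[sub [B SB]]; rewrite inE /= negb_imply => /andP[AB iB].
have /atom_systemP[_ _ _ SI] := valP S.
suff -> : A = B :&: (i |: A).
  by apply: SI (subsetP sub _ _); rewrite // !inE eqxx implybT.
apply/setP => j; rewrite !inE.
have [->|_] /= := eqVneq j i; last first.
  by apply/idP/andP => [jA|[]//]; rewrite (subsetP AB).
by rewrite (negPf iB); move: pA; rewrite inE => /andP[/negPf].
Qed.

Lemma system_ltP S T : lt_of (@system_le) S T <-> val S \proper val T.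
Proof.
rewrite properEneq; split=> [[sST /eqP neqST]|/andP[neqST sST]].
  by rewrite (inj_eq val_inj) neqST.
by split=> // eqST; rewrite eqST eqxx in neqST.
Qed.

Lemma setI_system S T : atom_system (val S :&: val T).
Proof.
have /atom_systemP[S0 ST S1 SI] := valP S.
have /atom_systemP[T0 TT T1 TI] := valP T.
apply/atom_systemP; split=> [||i|A B]; rewrite ?inE ?S0 ?ST ?S1 ?T0 ?TT ?T1 //.
by move=> /andP[SA TA] /andP[SB TB]; rewrite SI ?TI.
Qed.

Lemma rule_system_irreducible p : meet_irreducible system_le (rule_system p).
Proof.
case: p => -[A i] pA; split.
  have powerset_system : atom_system [set: {set 'I_n}].
    by apply/atom_systemP; split=> *; rewrite inE.
  move/(_ (System powerset_system))/subsetP/(_ A (in_setT _)).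
  exact/negP/premise_disobeys.
move=> S T /system_ltP ltS /system_ltP ltT [_ _ maxI].
have /negP := premise_disobeys pA; apply.
apply: (subsetP (maxI (System (setI_system S T)) _ _)).
- exact: subsetIl.
- exact: subsetIr.
- by rewrite inE !(premise_above_obeys pA).
Qed.

(** If A is not in S, some i in the closure of A lies outside A; then every
    member of S obeys (A, i) while A does not. The premise has at least two
    elements because S contains the empty set and the singletons. The rules are
    listed in a sequence so that binary meets suffice for
    [irreducible_rule_system]. *)
Lemma system_rules S : exists2 r : seq {p | p \in rules},
  (forall p, p \in r -> system_le S (rule_system p)) &
  val S = \bigcap_(p <- r) val (rule_system p).
Proof.
exists [seq p <- enum {: {p | p \in rules}}
       | val S \subset val (rule_system p)].
  by move=> p; rewrite mem_filter => /andP[].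
rewrite big_filter.
have /atom_systemP[S0 ST S1 SI] := valP S.
apply/eqP; rewrite eqEsubset; apply/andP; split.
  by rewrite big_enum_cond; apply/bigcapsP => p.
rewrite big_enum_cond; apply/subsetP => A /bigcapP Arules.
(* Closures are members of S, so A only has to be closed. *)
rewrite -[A](_ : closure S A = A) ?closure_in //.
apply/eqP; rewrite eqEsubset; apply/andP; split; last first.
  by apply/bigcapsP => C /andP[].
apply/subsetP => i icl; apply/negPn/negP => iA.
have S_obeys : val S \subset obeys (A, i).
  apply/subsetP => C SC; rewrite inE; apply/implyP => AC.
  by rewrite -(closure_sub _ SC) in AC; apply: subsetP AC _ icl.
have pA : (A, i) \in rules.
  rewrite inE iA /= ltnNge; apply/negP => /card_le1_eqP small.
  have SA : A \in val S.
    have [->//|[j jA]] := set_0Vmem A.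
    suff -> : A = [set j] by apply: S1.
    by apply/setP=> k; rewrite inE; apply/idP/eqP => [kA|->//]; apply: small.
  by have := subsetP S_obeys _ SA; rewrite inE subxx (negPf iA).
case/negP: (premise_disobeys pA).
exact: (Arules (exist (fun p => p \in rules) (A, i) pA)).
Qed.

(** Peel the rules off one at a time: S is the meet of one rule system and of
    the intersection T of the others, so it equals one of the two. The process
    cannot exhaust the rules, as the empty intersection is the top. *)
Lemma irreducible_rule_system S :
  meet_irreducible system_le S -> exists p, S = rule_system p.
Proof.
case=> not_top irr; have [r Sr defS] := system_rules S.
elim: r => [|p r IHr] in Sr defS.
  by case: not_top => T; rewrite /system_le defS big_nil subsetT.
pose T := \bigcap_(q <- r) val (rule_system q).
have sysT : atom_system T.
  rewrite /T; apply: (big_ind (fun U => atom_system U)) => [|U V sysU sysV|q _].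
  - by apply/atom_systemP; split=> *; rewrite inE.
  - exact: (setI_system (System sysU) (System sysV)).
  - exact: valP.
have {}defS : val S = val (rule_system p) :&: T by rewrite defS big_cons.
have [eqSp|neqp] := eqVneq S (rule_system p); first by exists p.
have [eqT|neqT] := eqVneq (val S) T.
  by apply: IHr eqT => q qr; apply: Sr; rewrite inE qr orbT.
have ltT : lt_of system_le S (System sysT).
  by apply/system_ltP; rewrite properEneq neqT defS subsetIr.
have ltp : lt_of system_le S (rule_system p).
  by split; [apply: Sr; rewrite mem_head | apply/eqP].
case: (irr _ _ ltp ltT); split; [by case: ltp | by case: ltT | ].
by move=> U Up UT; rewrite /system_le defS subsetI; apply/andP.
Qed.

(** Of the 2 ^ (n - 1) subsets avoiding i, exactly n have at most one element:
    the empty set and n - 1 singletons. *)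
Lemma card_premises i :
  #|[set A : {set 'I_n} | (i \notin A) && (1 < #|A|)%N]| = (2 ^ (n - 1) - n)%N.
Proof.
have cardC : #|[set~ i]| = (n - 1)%N by rewrite cardsC1 card_ord subn1.
have n_gt0 : (0 < n)%N by apply: leq_ltn_trans (ltn_ord i).
pose D k := [set A : {set 'I_n} | A \subset [set~ i] & #|A| == k].
have cardD k : #|D k| = 'C(n - 1, k) by rewrite /D cards_draws cardC.
set X := [set A | _].
have defP : powerset [set~ i] = X :|: (D 0 :|: D 1).
  apply/setP => A; rewrite !inE subsetC sub1set inE.
  by case: (i \in A) => //=; case: #|A| => [|[]].
have dis01 : [disjoint D 0 & D 1].
  rewrite disjoint_subset; apply/subsetP => A; rewrite !inE.
  by case/andP=> _ /eqP->; rewrite andbF.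
have disX : [disjoint X & D 0 :|: D 1].
  rewrite disjoint_subset; apply/subsetP => A; rewrite !inE.
  by case/andP=> _; case: #|A| => [|[|k]] //=; rewrite !andbF.
have := card_powerset [set~ i].
rewrite defP cardC; move: dis01 disX; rewrite -!leq_card_setU.
move=> /eqP dis01 /eqP ->; rewrite dis01 !cardD bin0 bin1 => <-.
by rewrite subnKC // addnK.
Qed.

Lemma card_rules : #|rules| = (n * (2 ^ (n - 1) - n))%N.
Proof.
pose Q A i := (i \notin A) && (1 < #|A|)%N.
rewrite -sum1_card (eq_bigl (fun p => true && Q p.1 p.2)); last first.
  by move=> p; rewrite inE.
rewrite -(pair_big_dep xpredT Q (fun _ _ => 1%N)) (exchange_big_dep xpredT) //=.
rewrite (eq_bigr (fun=> 2 ^ (n - 1) - n)%N) => [|i _].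
  by rewrite sum_nat_const card_ord.
by rewrite -(card_premises i) -sum1_card; apply: eq_bigl => A; rewrite inE.
Qed.

End Implications.

Local Close Scope order_scope.

Theorem proposition5p3 (n : nat) (hn : 1 <= n) :
  has_card (meet_irreducible (@L_le n)) (n * (2 ^ (n - 1) - n)).
Proof.
have transfer := meet_irreducible_iso (@class_of_inj n) (@class_of_surj n)
                                      (@L_leP n).
rewrite -card_rules -card_sig.
exists (fun k => class_of (rule_system (enum_val k))); split=> [j k|x].
  move/class_of_inj/(congr1 val)/obeys_inj => eq_rule.
  by apply/enum_val_inj/val_inj/eq_rule; apply: valP.
split=> [|[k ->]]; last by apply/transfer/rule_system_irreducible.
have [S ->] := class_of_surj x.
move/transfer/irreducible_rule_system => [p ->].
by exists (enum_rank p); rewrite enum_rankK.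
Qed.
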